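(* Consider the freeway model data of the context and assume that each $f_i$ ($i=1,\dots,n$) satisfies assumption (H) of the context. Then for every $r_2,\dots,r_n\ge 0$ with $r_i<\min(q_i,c_ia_i)$ for $i=2,\dots,n$, there exists a constant $C>0$ such that, with $p_n=1=s_{n+1}$, $$\sum_{i=1}^n\big(1+p_i(n-i)\big)s_{i+1}f_i(x_i)\ \ge\ C\sum_{i=1}^n(n+1-i)x_i$$ for all $x\in S=(0,a_1]\times\dots\times(0,a_n]$, $u\in U=(0,+\infty)\times[0,r_2]\times\dots\times[0,r_n]$ and $d=(d_2,\dots,d_n)\in[0,1]^{n-1}$, where $s_i=s_i(d,x,u)$, $i=2,\dots,n$, are given by the formula in the context.
   Context: Notation: $\mathbb{R}_+=[0,+\infty)$. Model data: an integer $n\ge 3$; constants $a_i>0$, $q_i\in(0,+\infty)$, $c_i\in(0,1]$ for $i=1,\dots,n$; constants $p_i\in[0,1)$ for $i=1,\dots,n-1$ and $p_n=1$; functions $f_i:[0,a_i]\to\mathbb{R}_+$ for $i=1,\dots,n$. For $x\in S$, $u=(u_1,\dots,u_n)\in(0,+\infty)\times\mathbb{R}_+^{n-1}$, $d=(d_2,\dots,d_n)\in[0,1]^{n-1}$ and $i=2,\dots,n$: $$s_i=(1-d_i)\min\Big(1,\max\Big(0,\tfrac{\min(q_i,c_i(a_i-x_i))-u_i}{(1-p_{i-1})f_{i-1}(x_{i-1})}\Big)\Big)+d_i\min\Big(1,\tfrac{\min(q_i,c_i(a_i-x_i))}{(1-p_{i-1})f_{i-1}(x_{i-1})}\Big),$$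 and $s_{n+1}:=1$. Assumption (H) (for each $i=1,\dots,n$): $f_i\in C^0([0,a_i];\mathbb{R}_+)$ satisfies $0<f_i(z)<z$ for all $z\in(0,a_i]$. There exists $\delta_i\in(0,a_i]$ such that $f_i$ is (strictly) increasing on $[0,\delta_i]$ and non-increasing on $[\delta_i,a_i]$. Moreover, there exist constants $L_i\in(0,1)$, $\tilde\delta_i\in(0,\delta_i]$ such that $f_i$ is $C^1$ on $(0,\delta_i)$, $1-L_i\le f_i'(z)$ for all $z\in(0,\tilde\delta_i)$, and $f_i'(z)\le 1$ for all $z\in(0,\delta_i)$. *)

(* Defs.v *)
From HB Require Import structures.
From mathcomp Require Import all_boot all_order all_algebra.
From mathcomp Require Import all_classical all_reals all_analysis.

Set Implicit Arguments.
Unset Strict Implicit.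
Unset Printing Implicit Defensive.

Import Order.TTheory GRing.Theory Num.Theory.
Import numFieldNormedType.Exports.

Local Open Scope classical_set_scope.
Local Open Scope ring_scope.

(* Families indexed by 1, ..., n (or 2, ..., n) are functions on nat of which
   only the values at those indices are constrained or used.  Likewise a
   function on [0, a] is a total function R -> R of which only the values on
   [0, a] matter. *)

(* Assumption (H) on a function f : [0, a] -> R_+.  The interval ]0, delta[ is
   open in R, so differentiability and continuity of derive1 f at its points do not
   depend on the values of f outside [0, a]. *)
Definition assumption_H (R : realType) (a : R) (f : R -> R) : Prop :=
  [/\ {within `[0, a], continuous f},
      (forall z, z \in `[0, a] -> 0 <= f z),
      (forall z, z \in `]0, a] -> 0 < f z < z) &
      exists2 delta : R, delta \in `]0, a] &
        [/\ {in `[0, delta] &, forall y z, y < z -> f y < f z},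
            {in `[delta, a] &, forall y z, y <= z -> f z <= f y} &
            exists L delta' : R,
              [/\ L \in `]0, 1[, delta' \in `]0, delta],
                  (forall z, z \in `]0, delta[ ->
                     derivable f z 1 /\ {for z, continuous (derive1 f)}),
                  (forall z, z \in `]0, delta'[ -> 1 - L <= derive1 f z) &
                  (forall z, z \in `]0, delta[ -> derive1 f z <= 1)]]].

(* The coefficients s_i = s_i(d, x, u), i = 2, ..., n+1, with s_(n+1) = 1.
   Since p_(i-1) < 1 and f_(i-1) > 0 on ]0, a_(i-1)], the denominator is
   positive whenever x is in S and 2 <= i <= n. *)
Definition flow_coef (R : realType) (n : nat) (a q c p : nat -> R)
    (f : nat -> R -> R) (d x u : nat -> R) (i : nat) : R :=
  if i == n.+1 then 1 else
  let supply := Num.min (q i) (c i * (a i - x i)) in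
  let demand := (1 - p i.-1) * f i.-1 (x i.-1) in
  (1 - d i) * Num.min 1 (Num.max 0 ((supply - u i) / demand))
  + d i * Num.min 1 (supply / demand).

(* Main.v *)
(** Each f_i dominates a linear function k_i z, so the only obstruction is a
    vanishing coefficient s_i, which requires cell i to be nearly full.  Hence
    the outflow of cell i-1 and the content of cell i cannot both be small
    compared with x_(i-1): sigma x_(i-1) <= s_i f_(i-1)(x_(i-1)) + x_i for some
    sigma > 0.  As s_(n+1) = 1, these inequalities chain downwards from i = n
    and bound every x_i by a multiple of the total outflow. *)

Require Import Defs.
From HB Require Import structures.
From mathcomp Require Import all_boot all_order all_algebra.
From mathcomp Require Import all_classical all_reals all_analysis.
From mathcomp Require Import ring lra zify.

Import Order.TTheory GRing.Theory Num.Theory.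
Import numFieldNormedType.Exports.

Local Open Scope classical_set_scope.
Local Open Scope ring_scope.

(** Near 0 the mean value theorem on [[0, z]], with [f 0 >= 0] and slope at least [1 - L], gives the
    bound. On [[e, a]], [f] increases and then does not increase, so its minimum [m] is attained at
    an endpoint, and [z <= a] turns [m] into [m / a * z]. *)
Lemma assumption_H_linear_lower_bound (R : realType) (a : R) (f : R -> R) :
  assumption_H a f ->
  exists2 k : R, 0 < k & forall z, z \in `]0, a] -> k * z <= f z.
Proof.
move=> [fcont fge0 fpos [de]]; rewrite in_itv /= => /andP[de0 dea].
move=> [finc fdec [L [e [+ + fder fL _]]]].
rewrite !in_itv /= => /andP[L0 L1] /andP[e0 ede].
have a0 : 0 < a by exact: lt_le_trans dea.
have ea : e <= a by exact: le_trans dea.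
have fa0 : 0 < f a by have /andP[] : 0 < f a < a by apply: fpos; rewrite in_itv /= a0 lexx.
have fe0 : 0 < f e by have /andP[] : 0 < f e < e by apply: fpos; rewrite in_itv /= e0 ea.
set m := Num.min (f e) (f a).
have m0 : 0 < m by rewrite lt_min fe0 fa0.
exists (Num.min (1 - L) (m / a)).
  by rewrite lt_min subr_gt0 L1 divr_gt0.
move=> z; rewrite in_itv /= => /andP[z0 za].
have [ze|ez] := leP z e.
  have [||w] := @MVT R f (derive1 f) 0 z z0.
  - move=> y; rewrite in_itv /= => /andP[y0 yz].
    have [|dfy _] := fder y.
      by rewrite in_itv /= y0 (lt_le_trans yz) // (le_trans ze).
    by rewrite derive1E; apply/derivableP.
  - apply: continuous_subspaceW fcont => y /=; rewrite !in_itv /= => /andP[-> yz].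
    exact: le_trans yz za.
  rewrite in_itv /= subr0 => /andP[w0 wz] fz.
  have dfw : 1 - L <= derive1 f w.
    by apply: fL; rewrite in_itv /= w0 (lt_le_trans wz).
  have f00 : 0 <= f 0 by apply: fge0; rewrite in_itv /= lexx ltW.
  apply: (@le_trans _ _ (derive1 f w * z)); last by rewrite -fz gerBl.
  by rewrite ler_pM2r// (le_trans _ dfw)// ge_min lexx.
have mfz : m <= f z.
  have [zde|dez] := leP z de.
    rewrite ge_min; apply/orP; left; apply/ltW/finc => //.
      by rewrite in_itv /= ede ltW.
    by rewrite in_itv /= zde ltW.
  rewrite ge_min; apply/orP; right; apply: fdec => //.
    by rewrite in_itv /= za ltW.
  by rewrite in_itv /= lexx dea.
apply: le_trans mfz; apply: (@le_trans _ _ (m / a * z)).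
  by rewrite ler_pM2r// ge_min lexx orbT.
by rewrite mulrAC ler_pdivrMr// ler_pM2l.
Qed.

Lemma convex_comb_ge (R : realType) (t l y z : R) :
  0 <= t <= 1 -> l <= y -> l <= z -> l <= (1 - t) * y + t * z.
Proof. by move=> /andP[t0 t1] ly lz; nra. Qed.

Lemma flow_coef_ge0 (R : realType) (n : nat) (a q c p : nat -> R)
    (f : nat -> R -> R) (d x u : nat -> R) (i : nat) :
  0 <= q i -> 0 <= c i -> x i <= a i -> 0 <= d i <= 1 ->
  p i.-1 <= 1 -> 0 <= f i.-1 (x i.-1) ->
  0 <= flow_coef n a q c p f d x u i.
Proof.
move=> q0 c0 xa d01 p1 f0; rewrite /flow_coef; case: ifP => // _.
apply: convex_comb_ge => //; rewrite le_min ler01 /=.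
  by rewrite le_max lexx.
apply: divr_ge0; first by rewrite le_min q0 mulr_ge0 ?subr_ge0.
by rewrite mulr_ge0 ?subr_ge0.
Qed.

(** A supply exceeding [u i] by [e] makes both numerators at least [e], and a demand at most [b]
    makes both quotients at least [e / b]. Truncation at 1 and the convex combination preserve this,
    whatever [d i] is. *)
Lemma flow_coef_lower_bound (R : realType) (n : nat) (a q c p : nat -> R)
    (f : nat -> R -> R) (d x u : nat -> R) (i : nat) (e b : R) :
  0 <= d i <= 1 -> 0 <= u i -> 0 < e -> 0 < b ->
  e + u i <= Num.min (q i) (c i * (a i - x i)) ->
  0 < (1 - p i.-1) * f i.-1 (x i.-1) <= b ->
  Num.min 1 (e / b) <= flow_coef n a q c p f d x u i.
Proof.
move=> d01 u0 e0 b0 supply_ge /andP[demand0 demand_le].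
rewrite /flow_coef; case: ifP => [_|_]; first by rewrite ge_min lexx.
have ratio_ge y : e <= y -> e / b <= y / ((1 - p i.-1) * f i.-1 (x i.-1)).
  move=> ey; apply: (@le_trans _ _ (y / b)).
    by rewrite ler_pM2r ?invr_gt0.
  by rewrite ler_pM2l ?(lt_le_trans e0)// lef_pV2 ?posrE.
have min1_le y : e / b <= y -> Num.min 1 (e / b) <= Num.min 1 y.
  by move=> ey; rewrite le_min !ge_min lexx ey orbT.
apply: convex_comb_ge => //; apply: min1_le.
  by rewrite le_max ratio_ge ?orbT// lerBrDr.
by rewrite ratio_ge// (le_trans _ supply_ge)// lerDl.
Qed.

(** If cell [i] holds at least [eta], its content alone dominates a multiple of the bounded
    [x i.-1]. Otherwise its supply has a margin, the coefficient is at least [t], and the linear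
    lower bound on [f i.-1] applies. Each entry of the minimum chosen for [sigma] serves one
    case. *)
Lemma content_le_outflow_add_next (R : realType) (n : nat) (a q c p : nat -> R)
    (f : nat -> R -> R) (r : R) (i : nat) :
  0 < a i.-1 -> 0 < c i -> 0 <= p i.-1 < 1 ->
  assumption_H (a i.-1) (f i.-1) -> 0 <= r < Num.min (q i) (c i * a i) ->
  exists2 sigma : R, 0 < sigma &
    forall d x u : nat -> R,
      x i.-1 \in `]0, a i.-1] -> x i \in `]0, a i] ->
      0 <= u i <= r -> 0 <= d i <= 1 ->
      sigma * x i.-1
      <= flow_coef n a q c p f d x u i * f i.-1 (x i.-1) + x i.
Proof.
move=> a0 c0 /andP[p0 p1] Hf /andP[r0]; rewrite lt_min => /andP[rq rca].
have [k k0 fk] := assumption_H_linear_lower_bound _ _ _ Hf.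
have [_ _ fpos _] := Hf.
(* c_i (a_i - x_i) = r at x_i = 2 eta, so below eta the supply exceeds u_i by a margin e. *)
pose eta := (a i - r / c i) / 2.
have eta0 : 0 < eta by rewrite divr_gt0// subr_gt0 ltr_pdivrMr// mulrC.
(* The midpoint of [r] and [c i * a i] lies strictly above [r], whence [e > 0]. *)
have ceta : c i * (a i - eta) = (c i * a i + r) / 2.
  by rewrite /eta; field; rewrite gt_eqF.
pose e := Num.min (q i) (c i * (a i - eta)) - r.
have e0 : 0 < e by rewrite subr_gt0 lt_min rq ceta; lra.
pose t := Num.min 1 (e / a i.-1).
have t0 : 0 < t by rewrite lt_min ltr01 divr_gt0.
exists (Num.min (eta / a i.-1) (t * k)); first by rewrite lt_min divr_gt0//= mulr_gt0.
move=> d x u xpred; have /andP[f0 fx] := fpos _ xpred.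
have kx := fk _ xpred; move: xpred; rewrite !in_itv /=.
move=> /andP[xp0 xpa] /andP[x0 xa] /andP[u0 ur] d01.
(* The upper bound combines [1 - p i.-1 <= 1] with [f z < z]. *)
have demand01 : 0 < (1 - p i.-1) * f i.-1 (x i.-1) <= a i.-1.
  by rewrite mulr_gt0 ?subr_gt0//=; nra.
have [etax|xeta] := leP eta (x i).
  have s0 : 0 <= flow_coef n a q c p f d x u i.
    apply: flow_coef_ge0 => //; [exact/ltW/(le_lt_trans r0)|exact: ltW..].
  rewrite -[leLHS]add0r lerD ?mulr_ge0//; first exact: ltW.
  apply: le_trans etax; apply: (@le_trans _ _ (eta / a i.-1 * x i.-1)).
    by rewrite ler_pM2r// ge_min lexx.
  by rewrite mulrAC ler_pdivrMr// ler_pM2l.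
have ts : t <= flow_coef n a q c p f d x u i.
  apply: flow_coef_lower_bound => //.
  apply: (@le_trans _ _ (e + r)); first by rewrite lerD2l.
  by rewrite subrK le_min !ge_min lexx /= ler_pM2l// lerD2l lerN2 (ltW xeta) orbT.
rewrite -[leLHS]addr0 lerD ?(ltW x0)//.
apply: (@le_trans _ _ (t * k * x i.-1)).
  by rewrite ler_pM2r// ge_min lexx orbT.
by rewrite -mulrA ler_pM// ?mulr_ge0// ltW.
Qed.

(** A minimum of finitely many constants; the cap at 1 makes the powers of [s] decrease in the
    chaining below. *)
Lemma uniform_pos_bound (R : realType) (P : nat -> R -> Prop) (n : nat) :
  (forall i s t, (1 <= i <= n)%N -> s <= t -> P i t -> P i s) ->
  (forall i, (1 <= i <= n)%N -> exists2 s : R, 0 < s & P i s) ->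
  exists2 s : R, 0 < s <= 1 & forall i, (1 <= i <= n)%N -> P i s.
Proof.
elim: n => [|n IHn] Pdown Pex.
  by exists 1 => [|[|i]//]; rewrite ltr01 lexx.
have [i s t /andP[i1 ile]||s /andP[s0 s1] Ps] := IHn.
- by apply: Pdown; rewrite i1 leqW.
- by move=> i /andP[i1 ile]; apply: Pex; rewrite i1 leqW.
have [|t t0 Pt] := Pex n.+1; first by rewrite /= leqnn.
have st0 : 0 < Num.min s t by rewrite lt_min s0 t0.
exists (Num.min s t); first by rewrite st0 ge_min s1.
move=> i /andP[i1 ile]; have [ein|nin] := eqVneq i n.+1.
  by subst i; apply: Pdown Pt; rewrite ?i1// ge_min lexx orbT.
apply: (Pdown _ _ s); rewrite ?i1 ?ge_min ?lexx//.
by apply: Ps; rewrite i1 -ltnS ltn_neqAle nin.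
Qed.

Lemma chained_bound (R : realType) (n : nat) (s : R) (A X : nat -> R) :
  0 < s <= 1 -> X n.+1 = 0 ->
  (forall i, (1 <= i <= n)%N -> 0 <= A i) ->
  (forall i, (1 <= i <= n)%N -> s * X i <= A i + X i.+1) ->
  forall i, (1 <= i <= n)%N -> s ^+ n * X i <= \sum_(1 <= j < n.+1) A j.
Proof.
move=> /andP[s0 s1] Xn A0 AX.
have sum_ge0 m : (1 <= m)%N -> 0 <= \sum_(m <= j < n.+1) A j.
  move=> m1; rewrite big_nat_cond; apply: sumr_ge0 => j /andP[/andP[mj jn] _].
  by apply: A0; rewrite (leq_trans m1 mj) -ltnS.
(* Here [m] counts cells from the downstream end, starting at [X n.+1 = 0]. Each step upstream costs
   one factor [s]. *)
have tail m : (m <= n)%N ->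
    s ^+ m * X (n.+1 - m)%N <= \sum_(n.+1 - m <= j < n.+1) A j.
  elim: m => [_|m IHm mn]; first by rewrite subn0 Xn mulr0 big_geq.
  have := IHm (ltnW mn); rewrite subSS.
  have -> : (n.+1 - m = (n - m).+1)%N by lia.
  set i := (n - m)%N => IH.
  have i1n : (1 <= i <= n)%N by rewrite /i; lia.
  rewrite big_ltn; last by rewrite ltnS; case/andP: i1n.
  apply: (@le_trans _ _ (s ^+ m * (A i + X i.+1))).
    by rewrite exprSr -mulrA ler_pM2l ?exprn_gt0// AX.
  by rewrite mulrDr lerD// ler_piMl ?A0// exprn_ile1// ltW.
(* Replacing [s ^+ (n.+1 - i)] by the smaller [s ^+ n] requires [X i >= 0]; for negative [X i] the
   claim is immediate. *)
move=> i /andP[i1 ile]; case: (leP 0 (X i)) => [Xi|Xi]; last first.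
  by apply: le_trans (sum_ge0 _ (leqnn _)); rewrite pmulr_rle0 ?exprn_gt0// ltW.
have := tail (n.+1 - i)%N; rewrite subKn ?(leqW ile)// => tl.
apply: (@le_trans _ _ (s ^+ (n.+1 - i) * X i)).
  by rewrite ler_wpM2r// ler_wiXn2l ?(ltW s0)//; lia.
apply: le_trans (tl _) _; first by lia.
rewrite [leRHS](@big_cat_nat _ _ _ i)//=; last exact: leqW.
rewrite lerDr big_nat_cond; apply: sumr_ge0 => j /andP[/andP[j1 ji] _].
by apply: A0; rewrite j1 ltnW// (leq_trans ji).
Qed.

Theorem mainTheorem2 (R : realType) (n : nat) (hn : (3 <= n)%N)
    (a q c p : nat -> R) (f : nat -> R -> R)
    (ha : forall i, (1 <= i <= n)%N -> 0 < a i)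
    (hq : forall i, (1 <= i <= n)%N -> 0 < q i)
    (hc : forall i, (1 <= i <= n)%N -> c i \in `]0, 1])
    (hp : forall i, (1 <= i < n)%N -> p i \in `[0, 1[)
    (hpn : p n = 1)
    (hf : forall i, (1 <= i <= n)%N -> assumption_H (a i) (f i))
    (r : nat -> R)
    (hr : forall i, (2 <= i <= n)%N ->
       0 <= r i /\ r i < Num.min (q i) (c i * a i)) :
  exists2 C : R, 0 < C &
    forall x u d : nat -> R,
      (forall i, (1 <= i <= n)%N -> x i \in `]0, a i]) ->
      0 < u 1%N ->
      (forall i, (2 <= i <= n)%N -> u i \in `[0, r i]) ->
      (forall i, (2 <= i <= n)%N -> d i \in `[0, 1]) ->
      C * (\sum_(1 <= i < n.+1) (n + 1 - i)%N%:R * x i)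
      <= \sum_(1 <= i < n.+1)
           (1 + p i * (n - i)%N%:R) * flow_coef n a q c p f d x u i.+1
           * f i (x i).
Proof.
pose admissible (x u d : nat -> R) :=
  [/\ forall i, (1 <= i <= n)%N -> x i \in `]0, a i],
      forall i, (2 <= i <= n)%N -> u i \in `[0, r i] &
      forall i, (2 <= i <= n)%N -> d i \in `[0, 1]].
pose outflow d x u i := flow_coef n a q c p f d x u i.+1 * f i (x i).
(* No cell follows cell [n], and [x n.+1] is unconstrained, so it is replaced by 0. *)
pose next_content (x : nat -> R) i : R := if (i < n)%N then x i.+1 else 0.
have [||s s01 s_bound] := @uniform_pos_bound R (fun i s => forall x u d,
    admissible x u d -> s * x i <= outflow d x u i + next_content x i) n.
- move=> i s t i1n st Pt x u d adm; apply: le_trans (Pt x u d adm).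
  rewrite ler_wpM2r//; case: adm => /(_ i i1n); rewrite in_itv /= => /andP[x0 _] _ _.
  exact: ltW.
(* For the last cell the coefficient is 1, so the linear lower bound on [f n] suffices; the other
   cells use the estimate with the next content. *)
- move=> i /andP[i1]; rewrite leq_eqVlt => /predU1P[->|ilt].
    have [|k k0 fk] := assumption_H_linear_lower_bound _ _ _ (hf n _).
      by rewrite leqnn andbT; lia.
    exists k => // x u d [hx _ _].
    rewrite /outflow /next_content /flow_coef eqxx ltnn mul1r addr0.
    by apply/fk/hx; rewrite leqnn andbT; lia.
  have i1n : (1 <= i <= n)%N by rewrite i1 ltnW.
  have j1n : (1 <= i.+1 <= n)%N by [].
  have j2n : (2 <= i.+1 <= n)%N by rewrite ltnS i1.
  have [||||sigma sigma0 bound] :=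
    @content_le_outflow_add_next R n a q c p f (r i.+1) i.+1 (ha i i1n).
  + by have := hc _ j1n; rewrite in_itv => /andP[].
  + by have := hp i; rewrite i1 ilt in_itv => /(_ isT).
  + exact: hf.
  + by have [-> ->] := hr _ j2n.
  exists sigma => // x u d [hx hu hd]; rewrite /next_content ilt.
  apply: bound; [exact: hx|exact: hx|..].
    by have := hu _ j2n; rewrite in_itv.
  by have := hd _ j2n; rewrite in_itv.
have s0 : 0 < s by case/andP: s01.
(* Every [x i] is at most [s ^- n] times the total outflow, so the weighted sum costs a further
   factor [N], the sum of the weights. *)
pose N : R := \sum_(1 <= i < n.+1) (n + 1 - i)%N%:R.
have N0 : 0 < N.
  rewrite /N big_ltn; last by lia.
  by apply: ltr_pwDl; [rewrite ltr0n; lia|apply: sumr_ge0].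
exists (s ^+ n / N); first by rewrite divr_gt0// exprn_gt0.
move=> x u d hx _ hu hd; have adm : admissible x u d by [].
have p0 i : (1 <= i <= n)%N -> 0 <= p i.
  move=> /andP[i1]; rewrite leq_eqVlt => /predU1P[->|ilt]; first by rewrite hpn.
  by have := hp i; rewrite i1 ilt in_itv => /(_ isT)/andP[].
have outflow_ge0 i : (1 <= i <= n)%N -> 0 <= outflow d x u i.
  move=> i1n; have xi := hx _ i1n; have /andP[i1] := i1n.
  have f0 : 0 <= f i (x i).
    by have [_ _ /(_ _ xi)/andP[/ltW]] := hf _ i1n.
  rewrite leq_eqVlt => /predU1P[ein|ilt].
    by rewrite /outflow /flow_coef ein eqxx mul1r -ein.
  have j2n : (2 <= i.+1 <= n)%N by rewrite ltnS i1.
  have j1n : (1 <= i.+1 <= n)%N by [].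
  apply: mulr_ge0 => //; apply: flow_coef_ge0 => //.
  - exact/ltW/hq.
  - by have := hc _ j1n; rewrite in_itv => /andP[/ltW].
  - by have := hx _ j1n; rewrite in_itv => /andP[].
  - by have := hd _ j2n; rewrite in_itv.
  - by have := hp i; rewrite i1 ilt in_itv => /(_ isT)/andP[_ /ltW].
have total_bound i : (1 <= i <= n)%N ->
    s ^+ n * x i <= \sum_(1 <= j < n.+1) outflow d x u j.
  move=> i1n; have := @chained_bound R n s (outflow d x u)
    (fun i => if (i <= n)%N then x i else 0) s01.
  rewrite ltnn => /(_ erefl outflow_ge0); case/andP: (i1n) => _ ile.
  move=> /(_ _ i i1n); rewrite ile; apply=> j j1n.
  by case/andP: (j1n) => _ ->; exact: s_bound adm.
apply: (@le_trans _ _ (\sum_(1 <= j < n.+1) outflow d x u j)).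
  rewrite mulrAC ler_pdivrMr// mulr_sumr mulrC.
  rewrite /N mulr_suml big_nat_cond [leRHS]big_nat_cond.
  apply: ler_sum => i /andP[/andP[i1 ile] _].
  by rewrite mulrCA ler_wpM2l// total_bound// i1.
(* The weights [1 + p i * (n - i)] are at least 1 and the outflows are nonnegative, so weighting
   only increases the sum. *)
rewrite big_nat_cond [leRHS]big_nat_cond.
apply: ler_sum => i /andP[/andP[i1 ile] _].
rewrite -mulrA ler_peMl ?outflow_ge0 ?i1// lerDl mulr_ge0//.
by rewrite p0 ?i1.
Qed.
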